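(* Let $G$ be a virtually polycyclic group. Then $G$ is strongly Howson and $\xi_G$ is a bounded function.
   Context: For a finitely generated group $H$, the rank is $\mathrm{rk}(H) = \min\{|X| : H = \langle X\rangle\}$ (infinite if $H$ is not finitely generated). A group $G$ is strongly Howson if for all $n_1,n_2 \in \mathbb{N}$, $$\sup\{\mathrm{rk}(H_1\cap H_2) \mid H_1,H_2\leq G,\ \mathrm{rk}(H_1)\leq n_1,\ \mathrm{rk}(H_2)\leq n_2\} < \infty.$$ In that case $\xi_G(n_1,n_2)$ denotes this supremum, defining a function $\xi_G:\mathbb{N}\times\mathbb{N}\to\mathbb{N}$. A group is polycyclic if it admits a finite subnormal series $G=G_0\rhd G_1\rhd\cdots\rhd G_n=\{1\}$ with all $G_{i-1}/G_i$ cyclic; it is virtually polycyclic if it has a polycyclic subgroup of finite index. *)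

(* Defs.v *)
From HB Require Import structures.
From mathcomp Require Import all_boot all_classical.

Set Implicit Arguments.
Unset Strict Implicit.
Unset Printing Implicit Defensive.

Local Open Scope classical_set_scope.
Local Open Scope card_scope.
Local Open Scope group_scope.

(* The extended naturals [nat] + infinity are represented by [option nat],
   with [None] for infinity. *)

Definition enat_le (r s : option nat) : bool :=
  match r, s with
  | _, None => true
  | None, Some _ => false
  | Some m, Some n => m <= n
  end.

(* The minimum of a set of naturals, infinity if the set is empty. *)
Definition enat_min (A : set nat) : option nat :=
  if pselect (exists n, `[< A n >]) is left exA then Some (ex_minn exA)
  else None.

(* The supremum of a set of extended naturals (0 if the set is empty). *)
Definition enat_sup (S : set (option nat)) : option nat :=
  enat_min [set m | forall r, S r -> enat_le r (Some m)].

Section Groups.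
Variable G : groupType.
Implicit Types (H K N P X : set G) (x y t : G).

Definition subgroup H : Prop := group_closed [in H].

Definition generated X : set G := smallest subgroup X.

Definition rk H : option nat :=
  enat_min [set n | exists X, X #= `I_n /\ H = generated X].

Definition normal_in N K : Prop :=
  [/\ subgroup N, N `<=` K & forall x k, N x -> K k -> N (x ^ k)].

Definition left_coset x N : set G := [set x * y | y in N].

(* For [N] normal in [K]: the group [K / N] of cosets is cyclic. The powers of
   the coset [t N] are the cosets of the powers of [t], with exponents [n] and
   [- n] for [n : nat]. *)
Definition cyclic_quotient K N : Prop :=
  exists2 t, K t & forall x, K x -> exists n : nat,
    left_coset x N = left_coset (t ^+ n) N \/
    left_coset x N = left_coset (t ^- n) N.

Definition polycyclic P : Prop :=
  exists (n : nat) (S : nat -> set G),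
    [/\ S 0 = P, S n = [set 1], forall i, i <= n -> subgroup (S i),
        forall i, i < n -> normal_in (S i.+1) (S i) &
        forall i, i < n -> cyclic_quotient (S i) (S i.+1)].

Definition finite_index P : Prop := finite_set (range (left_coset^~ P)).

End Groups.

Definition virtually_polycyclic (G : groupType) : Prop :=
  exists P : set G, [/\ subgroup P, polycyclic P & finite_index P].

Definition intersection_ranks (G : groupType) (n1 n2 : nat) :
    set (option nat) :=
  [set r | exists H1 H2 : set G,
    [/\ subgroup H1, subgroup H2, enat_le (rk H1) (Some n1),
        enat_le (rk H2) (Some n2) & r = rk (H1 `&` H2)]].

Definition strongly_howson (G : groupType) : Prop :=
  forall n1 n2, enat_sup (intersection_ranks G n1 n2) <> None.

(* Meaningful when [G] is strongly Howson; an infinite supremum is sent to 0. *)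
Definition xi (G : groupType) (n1 n2 : nat) : nat :=
  odflt 0 (enat_sup (intersection_ranks G n1 n2)).

(* Main.v *)
Require Import Defs.
From mathcomp Require Import all_boot all_classical.

(** The ranks of all subgroups of a virtually polycyclic group [G] are bounded
    by one constant, so the ranks of intersections are too, whatever [n1] and
    [n2] are.

    Let [P] be a polycyclic subgroup of index [m] with a series of length [n].
    A subgroup of a member [K] of the series meets the next member [N] in a
    subgroup that needs only one generator fewer, because its image in the
    cyclic group [K / N] is cyclic ([fg_le_cyclic_step]). Hence every subgroup
    of [P] is generated by at most [n] elements ([polycyclic_fg_le]). Finally a
    subgroup [H] of [G] is generated by [H `&` P] and one element in each
    coset of [P] that [H] meets, hence by at most [m + n] elements
    ([virtually_polycyclic_fg_le]). *)

Set Implicit Arguments.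
Unset Strict Implicit.
Unset Printing Implicit Defensive.

Local Open Scope classical_set_scope.
Local Open Scope card_scope.
Local Open Scope group_scope.

(** * Extended naturals *)

Lemma enat_min_le (A : set nat) (n : nat) :
  A n -> exists2 m, enat_min A = Some m & m <= n.
Proof.
move=> An; rewrite /enat_min.
case: pselect => [exA|[]]; last by exists n; apply/asboolP.
by case: ex_minnP => m _ /(_ n) le_m; exists m => //; apply/le_m/asboolP.
Qed.

Lemma enat_sup_le (S : set (option nat)) (b : nat) :
    (forall r, S r -> enat_le r (Some b)) ->
  exists2 m, enat_sup S = Some m & m <= b.
Proof. exact: enat_min_le. Qed.

(** * Subgroups and generators *)

Section Subgroups.
Variable G : groupType.
Implicit Types (H K L M N P X C : set G) (x y t h : G) (s : seq G).

Lemma subgroupP H :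
  subgroup H <-> H 1 /\ forall x y, H x -> H y -> H (x / y).
Proof.
split=> -[H1 HD]; split.
- by move: H1; rewrite inE.
- by move=> x y Hx Hy; apply/set_mem/HD; rewrite inE.
- by rewrite inE.
- by move=> x y /set_mem Hx /set_mem Hy; rewrite inE; apply: HD.
Qed.

Lemma subgroup1 H : subgroup H -> H 1.
Proof. by case/subgroupP. Qed.

Lemma subgroupV H x : subgroup H -> H x -> H x^-1.
Proof. by case/subgroupP=> H1 HD Hx; rewrite -[x^-1]mul1g; apply: HD. Qed.

Lemma subgroupM H x y : subgroup H -> H x -> H y -> H (x * y).
Proof.
move=> sgH Hx Hy; rewrite -[y]invgK; case/subgroupP: (sgH) => _; apply=> //.
exact: subgroupV.
Qed.

Lemma subgroupX H x n : subgroup H -> H x -> H (x ^+ n).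
Proof.
move=> sgH Hx; elim: n => [|n IHn]; first by rewrite expg0; apply: subgroup1.
by rewrite expgS; apply: subgroupM.
Qed.

Lemma subgroupI H K : subgroup H -> subgroup K -> subgroup (H `&` K).
Proof.
move=> /subgroupP[H1 HD] /subgroupP[K1 KD]; apply/subgroupP; split=> //.
by move=> x y [Hx Kx] [Hy Ky]; split; [apply: HD | apply: KD].
Qed.

Lemma generated_sub X H : subgroup H -> X `<=` H -> generated X `<=` H.
Proof. exact: smallest_sub. Qed.

Lemma card_set_seq (T : choiceType) (s : seq T) :
  uniq s -> [set` s] #= `I_(size s).
Proof.
elim: s => [|x s IHs] /= => [_|/andP[x_s /IHs card_s]].
  by rewrite set_nil II0 card_eq0.
apply/eq_cardSP; exists x; rewrite /= ?mem_head //.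
suff -> : [set` x :: s] `\ x = [set` s] by [].
apply/seteqP; split=> y /=.
  by case=> + yNx; rewrite inE => /predU1P[].
move=> s_y; split=> [|yx]; first by rewrite inE s_y orbT.
by rewrite -yx s_y in x_s.
Qed.

(** Counting generators by the length of a list leaves room for repetitions,
    so this bound on the rank is stable under concatenation of generators. *)
Definition fg_le (n : nat) H : Prop :=
  exists2 s : seq G, size s <= n & H = generated [set` s].

Lemma fg_le_rk n H : fg_le n H -> enat_le (rk H) (Some n).
Proof.
case=> s le_s defH.
suff [m] : exists2 m, rk H = Some m & m <= size (undup s).
  by move=> -> le_m; apply: leq_trans (leq_trans le_m (size_undup s)) le_s.
apply: enat_min_le; exists [set` undup s]; split; first exact/card_set_seq/undup_uniq.
rewrite defH; congr generated.
by apply/seteqP; split=> x /=; rewrite mem_undup.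
Qed.

Lemma fg_le_trivial n : fg_le n [set (1 : G)].
Proof.
exists [::] => //; apply/seteqP; split=> [x ->|].
  by move=> M [sgM _]; apply: subgroup1.
apply: generated_sub => [|x //]; apply/subgroupP; split=> // x y -> ->.
by rewrite divg1.
Qed.

Lemma fg_le_extend m n L M s :
    subgroup L -> M `<=` L -> [set` s] `<=` L -> size s <= m -> fg_le n M ->
    (forall C, subgroup C -> M `<=` C -> [set` s] `<=` C -> L `<=` C) ->
  fg_le (m + n) L.
Proof.
move=> sgL ML sL le_s [u le_u defM] genL; exists (s ++ u).
  by rewrite size_cat leq_add.
apply/seteqP; split=> [x Lx C [sgC suC]|].
  apply: (genL C) => //.
    rewrite defM; apply: generated_sub => // y u_y.
    by apply: suC; rewrite /= mem_cat; apply/orP; right.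
  by move=> y s_y; apply: suC; rewrite /= mem_cat; apply/orP; left.
apply: generated_sub => // x /=; rewrite mem_cat => /orP[/sL //|u_x].
by apply: ML; rewrite defM; apply: sub_gen_smallest.
Qed.

(** * Subgroups of polycyclic groups *)

Lemma left_coset_eq N x y :
  subgroup N -> left_coset x N = left_coset y N -> N (y^-1 * x).
Proof.
move=> sgN eq_xy; have : left_coset x N x.
  by exists 1; [apply: subgroup1 | rewrite mulg1].
by rewrite eq_xy => -[z Nz <-]; rewrite mulKg.
Qed.

(** The image of [L] in the cyclic group [K / N] is generated by the image of
    an [h] in [L] lying over the least positive power of the generator [t]
    that is reached: dividing by [h] lowers the exponent of an element of [L],
    and by minimality this only stops at exponent 0, that is, in [N]. *)
Lemma fg_le_cyclic_step n K N L :
    subgroup K -> normal_in N K -> cyclic_quotient K N ->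
    subgroup L -> L `<=` K -> fg_le n (L `&` N) ->
  fg_le n.+1 L.
Proof.
move=> sgK [sgN NK conjN] [t Kt cycK] sgL LK fgLN.
pose over e x := N (t ^- e * x).
have KX e : K (t ^+ e) by apply: subgroupX.
have over0 x : over 0 x -> N x by rewrite /over expg0 invg1 mul1g.
have overB e d x h : d <= e -> over e x -> over d h -> over (e - d) (h^-1 * x).
  move=> le_de ox oh; rewrite /over.
  have -> : t ^- (e - d) * (h^-1 * x)
          = ((t ^- d * h)^-1) ^ (t ^+ (e - d)) * (t ^- e * x).
    have -> : t ^- e = t ^- (e - d) * t ^- d.
      by rewrite -{1}(subnKC le_de) expgnDr invgM.
    rewrite conjgE !invgM invgK !mulgA; congr (_ * x).
    by rewrite !(mulgK, mulgVK) // -!mulgA mulVKg.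
  by apply: subgroupM => //; apply: conjN => //; apply: subgroupV.
have overP x : K x -> exists e, over e x \/ over e x^-1.
  move=> Kx; have [e [] /(left_coset_eq sgN) Nx] := cycK x Kx; exists e.
    by left.
  right; rewrite /over.
  have -> : t ^- e * x^-1 = ((t ^+ e * x)^-1) ^ (t ^+ e).
    by rewrite conjgE invgM !mulgA mulgVK.
  by apply: conjN => //; apply: subgroupV => //; rewrite invgK in Nx.
(* L is closed under inverses, so nonnegative exponents suffice. *)
have half C : subgroup C -> (forall e x, L x -> over e x -> C x) -> L `<=` C.
  move=> sgC overC x Lx; have [e [ox|oVx]] := overP x (LK x Lx).
    exact: (overC e).
  rewrite -(invgK x); apply: subgroupV => //.
  by apply: (overC e) => //; apply: subgroupV.
have LNL : L `&` N `<=` L by move=> x [].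
rewrite -add1n.
have [exd|nexd] :=
    pselect (exists e, `[< 0 < e /\ exists2 h, L h & over e h >]); last first.
  (* No positive power is reached: L lies in N, and no generator is added. *)
  apply: (@fg_le_extend 1 n L _ [::] _ LNL) => // C sgC LNC _.
  apply: half => // -[|e] x Lx ox; first by apply: LNC; split=> //; apply: over0.
  by case: nexd; exists e.+1; apply/asboolP; split=> //; exists x.
case: (ex_minnP exd) => d /asboolP[d_gt0 [h Lh oh]] min_d.
apply: (@fg_le_extend 1 n L _ [:: h] _ LNL) => //.
  by move=> x /=; rewrite inE => /eqP ->.
move=> C sgC LNC hC; apply: half => // e x Lx ox.
have Ch : C h by apply: hC; rewrite /= mem_head.
elim/ltn_ind: e => e IHe in x Lx ox *.
case: (posnP e) => [e0 | e_gt0].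
  by apply: LNC; split=> //; apply: over0; rewrite -e0.
have le_de : d <= e by apply: min_d; apply/asboolP; split=> //; exists x.
rewrite -(mulVKg h x); apply: subgroupM => //.
apply: (IHe (e - d)); first by rewrite ltn_subrL d_gt0.
  by apply: subgroupM => //; apply: subgroupV.
exact: overB.
Qed.

Lemma polycyclic_fg_le P :
  polycyclic P -> exists n, forall L, subgroup L -> L `<=` P -> fg_le n L.
Proof.
case=> n [S [S0 Sn sgS nS cycS]]; exists n; rewrite -S0.
suff fg_S k : k <= n -> forall L, subgroup L -> L `<=` S (n - k) -> fg_le k L.
  by move=> L sgL LS; apply: fg_S; rewrite ?subnn.
elim: k => [_ L sgL|k IHk lt_kn L sgL LS].
  rewrite subn0 Sn => L1; have -> : L = [set 1].
    by apply/seteqP; split=> // x ->; apply: subgroup1.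
  exact: fg_le_trivial.
have lt_i : n - k.+1 < n by rewrite ltn_subrL (leq_trans _ lt_kn).
have eq_i : (n - k.+1).+1 = n - k by rewrite subnSK.
apply: (fg_le_cyclic_step (sgS _ (ltnW lt_i)) (nS _ lt_i) (cycS _ lt_i)) => //.
rewrite eq_i; apply: IHk; rewrite ?(ltnW lt_kn) //.
  by apply: subgroupI => //; apply: sgS; rewrite leq_subr.
Qed.

(** * Passing to a supergroup of finite index *)

Lemma coset_representatives H (cs : seq (set G)) :
  exists s, [/\ size s <= size cs, [set` s] `<=` H &
    forall A x, A \in cs -> H x -> A x -> exists2 y, y \in s & A y].
Proof.
elim: cs => [|B cs [s [le_s sH reps]]]; first by exists [::].
have [[b [Hb Bb]]|nB] := pselect (exists b, H b /\ B b).
  exists (b :: s); split=> //.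
    by move=> y /=; rewrite inE => /predU1P[->|/sH].
  move=> A x; rewrite inE => /predU1P[-> _ _|csA Hx Ax].
    by exists b; rewrite ?mem_head.
  by have [y s_y Ay] := reps A x csA Hx Ax; exists y; rewrite // inE s_y orbT.
exists s; split=> //; first exact: leqW.
move=> A x; rewrite inE => /predU1P[-> Hx Bx|]; last exact: reps.
by case: nB; exists x.
Qed.

(** An element [x] of [H] differs from the chosen representative of its coset
    by an element of [P], which lies in [H] because the representatives are
    taken in [H]. *)
Lemma finite_index_fg_le P n :
    subgroup P -> finite_index P ->
    (forall L, subgroup L -> L `<=` P -> fg_le n L) ->
  exists m, forall H, subgroup H -> fg_le m H.
Proof.
move=> sgP /finite_seqP[cs defcs] fgP; exists (size cs + n) => H sgH.
have [s [le_s sH reps]] := coset_representatives H cs.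
have sgHP := subgroupI sgH sgP.
apply: (fg_le_extend sgH _ sH le_s (fgP _ sgHP _)); try by move=> x [].
move=> C sgC HPC sC x Hx.
have csx : left_coset x P \in cs.
  by have : [set` cs] (left_coset x P) by rewrite -defcs; exists x.
have xPx : left_coset x P x by exists 1; rewrite ?mulg1 //; apply: subgroup1.
have [y s_y [p Pp def_y]] := reps _ _ csx Hx xPx.
have def_p : p = x^-1 * y by rewrite -def_y mulKg.
have Cp : C p.
  apply: HPC; split=> //; rewrite def_p.
  by apply: subgroupM; [| apply: subgroupV | apply: sH].
have -> : x = y * p^-1 by rewrite -def_y mulgK.
by apply: subgroupM; [| apply: sC | apply: subgroupV].
Qed.

End Subgroups.

Lemma virtually_polycyclic_fg_le (G : groupType) :
    virtually_polycyclic G ->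
  exists m, forall H : set G, subgroup H -> fg_le m H.
Proof.
case=> P [sgP /polycyclic_fg_le[n fgP] finP].
exact: finite_index_fg_le sgP finP fgP.
Qed.

Theorem corollary3p6 (G : groupType) (hG : virtually_polycyclic G) :
  strongly_howson G /\
  exists B : nat, forall n1 n2 : nat, xi G n1 n2 <= B.
Proof.
have [B fgB] := virtually_polycyclic_fg_le hG.
have supB n1 n2 :
    exists2 m, enat_sup (intersection_ranks G n1 n2) = Some m & m <= B.
  apply: enat_sup_le => r [H1 [H2 [sgH1 sgH2 _ _ ->]]].
  exact/fg_le_rk/fgB/subgroupI.
split=> [n1 n2|]; first by have [m ->] := supB n1 n2.
by exists B => n1 n2; rewrite /xi; have [m ->] := supB n1 n2.
Qed.
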